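(* The diagram of constructions from strict homotopy relative Rota-Baxter algebras to $pre\text{-}Lie_\infty[1]$-algebras, through $Dend_\infty[1]$-algebras on the one hand and through strict homotopy relative Rota-Baxter Lie algebras on the other, commutes. That is, let $(A,\{\mu_k\}_{k\ge1})$ be an $A_\infty[1]$-algebra over a field of characteristic $0$, $(M,\{\eta_k\}_{k\ge1})$ a bimodule over it and $T:M\to A$ a strict homotopy relative Rota-Baxter operator. Then the $pre\text{-}Lie_\infty[1]$-algebra structure on $M$ associated to the $Dend_\infty[1]$-algebra induced by $T$ coincides with the $pre\text{-}Lie_\infty[1]$-algebra structure on $M$ induced by $T$ regarded as a strict homotopy relative Rota-Baxter operator on the representation $(M,\{\rho_k\}_{k\ge1})$ over the $L_\infty[1]$-algebra $(A,\{l_k\}_{k\ge1})$ obtained by symmetrization.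
   Context: $A_\infty[1]$-algebra: graded vector space $A$ with degree $1$ maps $\mu_k:A^{\otimes k}\to A$, $k\ge1$, with $\sum_{i+j=n+1}\sum_{\lambda=1}^j(-1)^{|a_1|+\cdots+|a_{\lambda-1}|}\mu_j(a_1,\ldots,a_{\lambda-1},\mu_i(a_\lambda,\ldots,a_{\lambda+i-1}),a_{\lambda+i},\ldots,a_n)=0$ for $n\ge1$. A bimodule is a graded vector space $M$ with degree $1$ maps $\eta_k$ from the direct sum of all tensor products of $k-1$ copies of $A$ and one of $M$ (any order) to $M$, satisfying the same identities when exactly one $a_i\in M$, with $\mu$ replaced by $\eta$ when it has an argument in $M$. A strict homotopy relative Rota-Baxter operator is a degree $0$ linear map $T:M\to A$ with $\mu_k(Tu_1,\ldots,Tu_k)=\sum_{r=1}^kT(\eta_k(Tu_1,\ldots,Tu_{r-1},u_r,Tu_{r+1},\ldots,Tu_k))$ for all $k\ge1$. The constructions ($\epsilon(\sigma)$ is the Koszul sign): - induced $Dend_\infty[1]$-algebra on $M$: $\mu_{k,[r]}(u_1,\ldots,u_k)=\eta_k(Tu_1,\ldots,Tu_{r-1},u_r,Tu_{r+1},\ldots,Tu_k)$ for $k\ge1$, $1\le r\le k$. - $Dend_\infty[1]\rightsquigarrow pre\text{-}Lie_\infty[1]$: $\theta_k(u_1,\ldots,u_k)=\sum_{\sigma\in S_k}\epsilon(\sigma)\mu_{k,[\sigma^{-1}(k)]}(u_{\sigma(1)},\ldots,u_{\sigma(k)})$. - symmetrization: $l_k(a_1,\ldots,a_k)=\sum_{\sigma\in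 S_k}\epsilon(\sigma)\mu_k(a_{\sigma(1)},\ldots,a_{\sigma(k)})$ for $a_i\in A$, and $\rho_k(a_1,\ldots,a_k)=\sum_{\sigma\in S_k}\epsilon(\sigma)\eta_k(a_{\sigma(1)},\ldots,a_{\sigma(k)})$ for $a_1,\ldots,a_{k-1}\in A$, $a_k\in M$; $T$ is then a strict homotopy relative Rota-Baxter operator on $(M,\{\rho_k\})$ over $(A,\{l_k\})$. - strict homotopy relative Rota-Baxter Lie algebra $\rightsquigarrow pre\text{-}Lie_\infty[1]$: $\theta'_k(u_1,\ldots,u_k)=\rho_k(Tu_1,\ldots,Tu_{k-1},u_k)$. Each of these is known to produce a structure of the stated type; two $pre\text{-}Lie_\infty[1]$ structures coincide if their structure maps agree, i.e. $\theta_k=\theta'_k$ for all $k\ge1$. *)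

(* Defs.v *)
From HB Require Import structures.
From mathcomp Require Import all_boot all_order all_algebra all_fingroup.

Set Implicit Arguments.
Unset Strict Implicit.
Unset Printing Implicit Defensive.

Import GRing.Theory.
Local Open Scope ring_scope.

(* Z-graded vector spaces, as internal direct sums: [homog d] is the
   component of degree [d].  No finiteness condition is imposed. *)
Record gradedSpace (K : fieldType) := GradedSpace {
  gs_sort :> lmodType K;
  homog : int -> gs_sort -> Prop;
  homog0 : forall d, homog d 0;
  homogZD : forall d (c : K) x y,
    homog d x -> homog d y -> homog d (c *: x + y);
  homog_span : forall x, exists (s : seq int) (c : int -> gs_sort),
    [/\ uniq s, forall d, homog d (c d) & x = \sum_(d <- s) c d];
  homog_free : forall (s : seq int) (c : int -> gs_sort),
    uniq s -> (forall d, homog d (c d)) ->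
    \sum_(d <- s) c d = 0 -> forall d, d \in s -> c d = 0
}.

(* Homogeneous elements, carrying their degree (0 has every degree). *)
Record homel (K : fieldType) (V : gradedSpace K) := Homel {
  hval :> V;
  hdeg : int;
  hvalP : homog hdeg hval
}.

Record deg0map (K : fieldType) (V W : gradedSpace K) := Deg0map {
  deg0fun :> {linear V -> W};
  deg0P : forall d x, homog d x -> homog d (deg0fun x)
}.

Definition hmap (K : fieldType) (V W : gradedSpace K) (T : deg0map V W)
    (x : homel V) : homel W :=
  Homel (deg0P T (hvalP x)).

(* A family of maps mu_k : V^k -> W, k >= 1, is encoded as one function
   [seq V -> W], the arity being the length of the argument; the value at the
   empty sequence plays no role. *)
Section AinfAlgebra.
Variables (K : fieldType) (A : gradedSpace K).
Implicit Type mu : seq A -> A.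

Definition multilinear_op mu :=
  forall (p q : seq A) (c : K) (x y : A),
    mu (p ++ (c *: x + y) :: q) = c *: mu (p ++ x :: q) + mu (p ++ y :: q).

Definition degree1_op mu :=
  forall a : seq (homel A), (0 < size a)%N ->
    homog (\sum_(x <- a) hdeg x + 1) (mu [seq hval x | x <- a]).

(* Here n = size a, j = n + 1 - i and l = lambda - 1. *)
Definition Ainf_identities mu :=
  forall a : seq (homel A),
    \sum_(1 <= i < (size a).+1) \sum_(0 <= l < (size a).+1 - i)
      (-1) ^ (\sum_(x <- take l a) hdeg x) *:
        (let b := [seq hval x | x <- a] in
         mu (take l b ++ mu (take i (drop l b)) :: drop (l + i) b)) = 0.

Record is_Ainf_algebra mu : Prop := IsAinfAlgebra {
  Ainf_multilinear : multilinear_op mu;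
  Ainf_degree : degree1_op mu;
  Ainf_identity : Ainf_identities mu
}.

End AinfAlgebra.

(* The family eta_k is encoded as one function on words whose letters are in
   A or in M; only its values on words with exactly one letter in M matter. *)
Section Bimodule.
Variables (K : fieldType) (A M : gradedSpace K).
Implicit Types (mu : seq A -> A) (eta : seq (A + M) -> M).

Definition isM (B N : Type) (x : B + N) : bool :=
  if x is inr _ then true else false.

Definition oneM (B N : Type) (w : seq (B + N)) : bool :=
  count (@isM B N) w == 1%N.

Definition ldeg (x : homel A + homel M) : int :=
  match x with inl a => hdeg a | inr m => hdeg m end.

Definition lval (x : homel A + homel M) : A + M :=
  match x with inl a => inl (hval a) | inr m => inr (hval m) end.

Definition Aletters (w : seq (A + M)) : seq A :=
  pmap (fun x => if x is inl a then Some a else None) w.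

(* mu, replaced by eta when there is an argument in M. *)
Definition mixed_op mu eta (w : seq (A + M)) : A + M :=
  if has (@isM A M) w then inr (eta w) else inl (mu (Aletters w)).

Definition multilinear_eta eta :=
  (forall (p q : seq (A + M)) (c : K) (x y : A), oneM (p ++ q) ->
     eta (p ++ inl (c *: x + y) :: q) =
       c *: eta (p ++ inl x :: q) + eta (p ++ inl y :: q)) /\
  (forall (p q : seq (A + M)) (c : K) (x y : M), ~~ has (@isM A M) (p ++ q) ->
     eta (p ++ inr (c *: x + y) :: q) =
       c *: eta (p ++ inr x :: q) + eta (p ++ inr y :: q)).

Definition degree1_eta eta :=
  forall w : seq (homel A + homel M), oneM w ->
    homog (\sum_(x <- w) ldeg x + 1) (eta [seq lval x | x <- w]).

Definition bimodule_identities mu eta :=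
  forall w : seq (homel A + homel M), oneM w ->
    \sum_(1 <= i < (size w).+1) \sum_(0 <= l < (size w).+1 - i)
      (-1) ^ (\sum_(x <- take l w) ldeg x) *:
        (let b := [seq lval x | x <- w] in
         eta (take l b ++ mixed_op mu eta (take i (drop l b))
                :: drop (l + i) b)) = 0.

Record is_bimodule mu eta : Prop := IsBimodule {
  bimodule_multilinear : multilinear_eta eta;
  bimodule_degree : degree1_eta eta;
  bimodule_identity : bimodule_identities mu eta
}.

End Bimodule.

(* From here on, operations of arity k >= 1 are indexed by n = k - 1, and
   positions run over 'I_n.+1, starting from 0. *)
Section Constructions.
Variables (K : fieldType) (A M : gradedSpace K).
Implicit Types (mu : seq A -> A) (eta : seq (A + M) -> M) (T : deg0map M A).

Definition dend_ops := forall n, 'I_n.+1 -> ('I_n.+1 -> M) -> M.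

(* Maps given by Koszul-signed formulas are recorded by their values on
   homogeneous elements, which determine them by multilinearity. *)
Definition preLie_ops := forall n, ('I_n.+1 -> homel M) -> M.

Definition induced_dend eta T : dend_ops :=
  fun n r u =>
    eta [seq (if i == r then inr (u i) else inl (T (u i))) | i <- enum 'I_n.+1].

Definition is_strict_RB mu eta T :=
  forall n (u : 'I_n.+1 -> M),
    mu [seq T (u i) | i <- enum 'I_n.+1] =
    \sum_(r < n.+1) T (induced_dend eta T r u).

(* The sign with x_(s 1) ... x_(s k) = sign * x_1 ... x_k in the free graded
   commutative algebra, where x_i has degree [d i]. *)
Definition koszul k (d : 'I_k -> int) (s : 'S_k) : K :=
  \prod_(i < k) \prod_(j < k | (i < j)%N && (s j < s i)%N)
    (-1) ^ (d (s i) * d (s j)).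

Definition preLie_of_dend (D : dend_ops) : preLie_ops :=
  fun n u =>
    \sum_(s : 'S_n.+1) koszul (fun i => hdeg (u i)) s *:
      D n ((s^-1)%g ord_max) (fun i => hval (u (s i))).

(* The operations underlying a strict homotopy relative Rota-Baxter Lie
   algebra; [rbl_action n] has n arguments in A and a last one in M. *)
Record RBLie_data := RBLieData {
  rbl_bracket : forall n, ('I_n.+1 -> homel A) -> A;
  rbl_action : forall n, ('I_n -> homel A) -> homel M -> M;
  rbl_map : deg0map M A
}.

Definition sym_bracket mu n (a : 'I_n.+1 -> homel A) : A :=
  \sum_(s : 'S_n.+1) koszul (fun i => hdeg (a i)) s *:
    mu [seq hval (a (s i)) | i <- enum 'I_n.+1].

(* The word a_1, ..., a_n, m. *)
Definition append_letter n (a : 'I_n -> homel A) (m : homel M) (i : 'I_n.+1) :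
    homel A + homel M :=
  if unlift ord_max i is Some j then inl (a j) else inr m.

Definition sym_action eta n (a : 'I_n -> homel A) (m : homel M) : M :=
  let w := append_letter a m in
  \sum_(s : 'S_n.+1) koszul (fun i => ldeg (w i)) s *:
    eta [seq lval (w (s i)) | i <- enum 'I_n.+1].

Definition symmetrization mu eta T : RBLie_data :=
  RBLieData (sym_bracket mu) (sym_action eta) T.

Definition preLie_of_RBLie (L : RBLie_data) : preLie_ops :=
  fun n u =>
    rbl_action L (fun i : 'I_n => hmap (rbl_map L) (u (lift ord_max i)))
      (u ord_max).

End Constructions.

(* Main.v *)
Require Import Defs.
From HB Require Import structures.
From mathcomp Require Import all_boot all_order all_algebra all_fingroup.

Set Implicit Arguments.
Unset Strict Implicit.
Unset Printing Implicit Defensive.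

Import GRing.Theory.
Local Open Scope ring_scope.

(** Both structures are sums over the same permutations and agree term by term. Permuting the word
    Tu_1, ..., Tu_n, u_(n+1) by [s] moves its only letter from M to position [s^-1 ord_max], which
    is exactly the index of the dendriform operation in the term of [s]. *)

Theorem proposition7p12 (K : fieldType) (charK : [pchar K] =i pred0)
  (A : gradedSpace K) (mu : seq A -> A) (muP : is_Ainf_algebra mu)
  (M : gradedSpace K) (eta : seq (A + M) -> M) (etaP : is_bimodule mu eta)
  (T : deg0map M A) (TP : is_strict_RB mu eta T)
  (n : nat) (u : 'I_n.+1 -> homel M) :
  preLie_of_dend (induced_dend eta T) u =
  preLie_of_RBLie (symmetrization mu eta T) u.
Proof.
rewrite /preLie_of_dend /preLie_of_RBLie /= /sym_action.
set w := append_letter _ _.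
have wE i : w i = if i == ord_max then inr (u i) else inl (hmap T (u i)).
  rewrite /w /append_letter.
  by case: unliftP => [j ->|->]; rewrite ?eqxx // eq_sym (negPf (neq_lift _ _)).
(* As [T] has degree 0, replacing u_i by Tu_i changes no degree, hence no Koszul sign. *)
have degE i : ldeg (w i) = hdeg (u i) by rewrite wE; case: ifP.
apply: eq_bigr => s _; congr (_ *: _).
  by apply: eq_bigr => i _; apply: eq_bigr => j _; rewrite !degE.
rewrite /induced_dend; congr eta; apply: eq_map => i.
(* The letter at [i] lies in M iff [s i = ord_max]; by injectivity of [s] this means
   [i = s^-1 ord_max]. *)
by rewrite wE -(inj_eq (@perm_inj _ s)) permKV; case: ifP.
Qed.
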